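(* Let $\mathbb{K}$ be a field of characteristic zero and let $V$ be a $4$-dimensional $\mathbb{K}$-vector space. In the affine space $ss\mathcal{A}lg_4\cong\mathbb{K}^{24}$ of skew-symmetric bilinear maps $\mu:V\times V\to V$ there is a nonempty Zariski-open set such that, for every $\mu$ in it, the algebra $(V,\mu)$ admits no Hom-Lie structure; that is, no nonzero linear map $f:V\to V$ satisfies $$\mu(\mu(x,y),f(z))+\mu(\mu(y,z),f(x))+\mu(\mu(z,x),f(y))=0\quad\text{for all } x,y,z\in V.$$
   Context: $ss\mathcal{A}lg_4$ is the $24$-dimensional vector space of all skew-symmetric bilinear maps $\mu:V\times V\to V$ (i.e. $\mu(X,Y)=-\mu(Y,X)$), identified with $\mathbb{K}^{24}$ via the structure constants $C_{i,j}^k$ ($1\le i<j\le 4$, $1\le k\le 4$) in a fixed basis $\{e_1,\dots,e_4\}$, where $\mu(e_i,e_j)=\sum_k C_{i,j}^k e_k$. The algebra $(V,\mu)$ admits a Hom-Lie structure if there is a nonzero linear map $f:V\to V$ satisfying the displayed Hom-Jacobi identity. *)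

(* Defs.v *)
From HB Require Import structures.
From mathcomp Require Import all_boot all_order all_algebra.
From mathcomp Require Export sesquilinear.
From mathcomp Require Export mpoly.

Set Implicit Arguments.
Unset Strict Implicit.
Unset Printing Implicit Defensive.

Import GRing.Theory.
Local Open Scope ring_scope.

(* Over an arbitrary field: the complement in K^n of the common zero locus of
   a (possibly infinite) family of polynomials. *)
Definition zariski_open (K : fieldType) (n : nat) (A : ('I_n -> K) -> Prop) :=
  exists S : {mpoly K[n]} -> Prop,
    forall v : 'I_n -> K, A v <-> exists2 p, S p & p.@[v] != 0.

Record ssAlg (K : fieldType) (V : vectType K) := SsAlg {
  ss_mul :> {bilinear V -> V -> V};
  ss_mulC : forall x y : V, ss_mul x y = - ss_mul y x }.

(* ((i, j), k) with i < j indexes the structure constant C_{i,j}^k. *)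
Definition sc_index (n : nat) :=
  {t : 'I_n * 'I_n * 'I_n | (t.1.1 < t.1.2)%N}.

Definition sc_dim (n : nat) : nat := #|{: sc_index n}|.

Lemma sc_dim4 : sc_dim 4 = 24%N.
Proof.
rewrite /sc_dim card_sig -sum1_card big_mkcond /=.
rewrite -(pair_bigA _ (fun (a : 'I_4 * 'I_4) (_ : 'I_4) =>
  if (a.1 < a.2)%N then 1%N else 0%N)) /=.
rewrite -(pair_bigA _ (fun i j : 'I_4 =>
  \sum_(k < 4) if (i < j)%N then 1%N else 0%N)) /=.
by rewrite !big_ord_recl !big_ord0.
Qed.

(* The entries C_{i,j}^k, where mu(e_i, e_j) = \sum_k C_{i,j}^k e_k, listed
   along the enumeration of sc_index n. *)
Definition struct_const (K : fieldType) (V : vectType K) (n : nat)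
    (e : n.-tuple V) (mu : ssAlg V) : 'I_(sc_dim n) -> K :=
  fun a => let: (i, j, k) := val (enum_val a) in
           coord e k (mu (tnth e i) (tnth e j)).

(* For e a basis of V, struct_const e identifies ssAlg V with the affine space
   K^(sc_dim n); the Zariski topology is transported along it. *)
Definition ssAlg_open (K : fieldType) (V : vectType K) (n : nat)
    (e : n.-tuple V) (U : ssAlg V -> Prop) :=
  exists2 A : ('I_(sc_dim n) -> K) -> Prop,
    zariski_open A & forall mu, U mu <-> A (struct_const e mu).

Definition hom_jacobi (K : fieldType) (V : vectType K) (mu : ssAlg V)
    (f : 'End(V)) :=
  forall x y z : V,
    mu (mu x y) (f z) + mu (mu y z) (f x) + mu (mu z x) (f y) = 0.

Definition admits_hom_lie (K : fieldType) (V : vectType K) (mu : ssAlg V) :=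
  exists2 f : 'End(V), f != 0 & hom_jacobi mu f.

(* Main.v *)
(* On the basis triples of a 4-dimensional V, the Hom-Jacobi identity is a
   system of 16 linear equations in the 16 entries of f, so a Hom-Lie structure
   forces the determinant of the system to vanish. This determinant is a
   polynomial in the structure constants, and the open set is its nonvanishing
   locus; it is nonempty because some algebra has a triangular system with
   diagonal entries 1 and -1. *)
Require Import Defs.
From HB Require Import structures.
From mathcomp Require Import all_boot all_order all_algebra.
From mathcomp Require Import ring.

Set Implicit Arguments.
Unset Strict Implicit.
Unset Printing Implicit Defensive.

Import GRing.Theory.
Local Open Scope ring_scope.

(** * The Hom-Jacobi identity as a square linear system *)

Section HomJacobiSystem.
Variables (R : comNzRingType) (n : nat) (C : 'I_n -> 'I_n -> 'I_n -> R).

(* The coordinate on e_l of mu(mu(e_i, e_j), f(e_k)), where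
   mu(e_i, e_j) = \sum_k C_{i,j}^k e_k and row k of F lists the coordinates
   of f(e_k). *)
Definition jacobi_term (F : 'M[R]_n) (i j k l : 'I_n) : R :=
  \sum_p \sum_m C i j p * F k m * C p m l.

Lemma jacobi_term_linear a F G i j k l :
  jacobi_term (a *: F + G) i j k l
    = a * jacobi_term F i j k l + jacobi_term G i j k l.
Proof.
rewrite mulr_sumr -big_split; apply: eq_bigr => p _ /=.
rewrite mulr_sumr -big_split; apply: eq_bigr => m _ /=.
by rewrite !mxE; ring.
Qed.
End HomJacobiSystem.

Section HomJacobiMatrix.
Variables (R : comNzRingType) (C : 'I_4 -> 'I_4 -> 'I_4 -> R).

(* Ordinals are added modulo 4: t + 1, t + 2, t + 3 are the indices other
   than t, so row t is the Hom-Jacobi identity on the basis triple omitting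
   e_t. *)
Definition hom_jacobi_map (F : 'M[R]_4) : 'M[R]_4 :=
  \matrix_(t, l) (jacobi_term C F (t + 1) (t + 2) (t + 3) l
                + jacobi_term C F (t + 2) (t + 3) (t + 1) l
                + jacobi_term C F (t + 3) (t + 1) (t + 2) l).

Lemma hom_jacobi_map_is_linear : linear hom_jacobi_map.
Proof.
by move=> a F G; apply/matrixP=> t l; rewrite !mxE !jacobi_term_linear; ring.
Qed.

HB.instance Definition _ :=
  GRing.isLinear.Build R 'M[R]_4 'M[R]_4 *:%R hom_jacobi_map
    hom_jacobi_map_is_linear.

Definition hom_jacobi_det : R := \det (lin_mx hom_jacobi_map).
End HomJacobiMatrix.

(** The matrix entries are integer polynomials in the table, so ring morphisms commute with the
    determinant. Serves both to evaluate the generic determinant at a point and, with the identity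
    morphism, to exchange pointwise equal tables. *)
Lemma rmorph_hom_jacobi_det (R S : comNzRingType) (phi : {rmorphism R -> S})
    (C : 'I_4 -> 'I_4 -> 'I_4 -> R) (D : 'I_4 -> 'I_4 -> 'I_4 -> S) :
  (forall i j k, phi (C i j k) = D i j k) ->
  phi (hom_jacobi_det C) = hom_jacobi_det D.
Proof.
move=> phiC; rewrite /hom_jacobi_det -det_map_mx; congr (\det _).
apply: map_lin_mx => F; apply/matrixP => t l; rewrite !mxE !rmorphD /=.
have phi_term i j k l' :
    phi (jacobi_term C F i j k l') = jacobi_term D (map_mx phi F) i j k l'.
  rewrite rmorph_sum; apply: eq_bigr => p _ /=.
  rewrite rmorph_sum; apply: eq_bigr => m _ /=.
  by rewrite !rmorphM !phiC mxE.
by rewrite !phi_term.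
Qed.

Lemma hom_jacobi_det_eq0P (K : fieldType) (C : 'I_4 -> 'I_4 -> 'I_4 -> K) :
  reflect (exists2 F, F != 0 & hom_jacobi_map C F = 0) (hom_jacobi_det C == 0).
Proof.
apply: (iffP det0P) => [[v v0 vM]|[F F0 hF]].
  exists (vec_mx v); first by rewrite vec_mx_eq0.
  by apply/eqP; rewrite -mxvec_eq0 -mul_vec_lin vec_mxK vM.
by exists (mxvec F); rewrite ?mxvec_eq0 // mul_vec_lin /= hF linear0.
Qed.

(** * Coordinates: algebras versus tables of structure constants *)

Section StructureConstants.
Variables (K : fieldType) (V : vectType K) (n : nat) (e : n.-tuple V).
Hypothesis basis_e : basis_of {:V} e.

Definition mul_table (mu : ssAlg V) (i j k : 'I_n) : K :=
  coord e k (mu (tnth e i) (tnth e j)).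

Definition sc_var (i j k : 'I_n) : {mpoly K[sc_dim n]} :=
  if insub ((i, j), k) is Some a then 'X_(enum_rank (a : sc_index n)) else 0.

(** Since [sc_var] is 0 unless its first index is below its second, at most one term survives: the
    difference is the antisymmetric extension of the variables, with zero diagonal. *)
Definition generic_table (i j k : 'I_n) : {mpoly K[sc_dim n]} :=
  sc_var i j k - sc_var j i k.

Lemma sc_var_eval (mu : ssAlg V) i j k :
  (sc_var i j k).@[struct_const e mu] =
  if (i < j)%N then mul_table mu i j k else 0.
Proof.
rewrite /sc_var; case: insubP => [a /= ij va|/= /negbTE ->]; last exact: meval0.
by rewrite mevalXU /struct_const enum_rankK ij; case: a va => t lt_t /= ->.
Qed.

Lemma mul_tableC mu i j k : mul_table mu i j k = - mul_table mu j i k.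
Proof. by rewrite /mul_table ss_mulC linearN. Qed.

Lemma generic_table_eval (mu : ssAlg V) i j k : 2%:R != 0 :> K ->
  (generic_table i j k).@[struct_const e mu] = mul_table mu i j k.
Proof.
move=> two_neq0; rewrite mevalB !sc_var_eval; case: ltngtP => [||/val_inj <-].
- by rewrite subr0.
- by rewrite sub0r -mul_tableC.
(* On the diagonal, skew-symmetry only gives that twice the constant is 0; dividing by 2
   concludes. *)
rewrite subr0; apply/esym/eqP; rewrite -(mulrI_eq0 _ (mulfI two_neq0)).
by rewrite mulr_natl mulr2n {1}mul_tableC addNr.
Qed.

Lemma tnth_coord v : v = \sum_i coord e i v *: tnth e i.
Proof.
rewrite {1}(coord_basis basis_e (memvf v)); apply: eq_bigr => i _.
by rewrite (tnth_nth 0).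
Qed.

Lemma coord_tnth i j : coord e i (tnth e j) = (i == j)%:R.
Proof. by rewrite (tnth_nth 0) coord_free ?(basis_free basis_e) // eq_sym. Qed.

Lemma coord_lincomb (c : 'I_n -> K) k :
  coord e k (\sum_i c i *: tnth e i) = c k.
Proof.
rewrite linear_sum (bigD1 k) //= big1 => [|i ik]; last first.
  by rewrite linearZ /= coord_tnth eq_sym (negbTE ik) mulr0.
by rewrite linearZ /= coord_tnth eqxx mulr1 addr0.
Qed.

Definition end_mx (f : 'End(V)) : 'M[K]_n :=
  \matrix_(i, j) coord e j (f (tnth e i)).

Lemma end_mx_eq0 f : (end_mx f == 0) = (f == 0).
Proof.
apply/eqP/eqP => [f0|->]; last first.
  by apply/matrixP=> i j; rewrite !mxE zero_lfunE linear0.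
apply/lfunP => v; rewrite zero_lfunE (tnth_coord v) linear_sum big1 // => i _.
rewrite linearZ /= (tnth_coord (f _)) big1 ?scaler0 // => j _.
by move/matrixP/(_ i j): f0; rewrite !mxE => ->; rewrite scale0r.
Qed.

Lemma coord_mul (mu : ssAlg V) x y l :
  coord e l (mu x y)
    = \sum_i \sum_j coord e i x * coord e j y * mul_table mu i j l.
Proof.
rewrite {1}(tnth_coord x) linear_sumlz linear_sum; apply: eq_bigr => i _.
rewrite linearZl_LR linearZ /= {1}(tnth_coord y) linear_sumr linear_sum.
rewrite mulr_sumr.
by apply: eq_bigr => j _; rewrite linearZr_LR linearZ /= mulrA.
Qed.

Lemma coord_jacobi_term (mu : ssAlg V) (f : 'End(V)) i j k l :
  coord e l (mu (mu (tnth e i) (tnth e j)) (f (tnth e k)))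
    = jacobi_term (mul_table mu) (end_mx f) i j k l.
Proof.
by rewrite coord_mul; do 2!apply: eq_bigr => ? _; rewrite mxE.
Qed.

Section AlgebraOfTable.
Variable C : 'I_n -> 'I_n -> 'I_n -> K.
Hypothesis antisymC : forall i j k, C i j k = - C j i k.

Definition table_mul (x y : V) : V :=
  \sum_k (\sum_i \sum_j coord e i x * coord e j y * C i j k) *: tnth e k.

Lemma table_mul_is_bilinear :
  bilinear_for (GRing.Scale.Law.clone _ _ *:%R _)
    (GRing.Scale.Law.clone _ _ *:%R _) table_mul.
Proof.
split=> [y|y] a u v /=; rewrite /table_mul scaler_sumr -big_split;
  apply: eq_bigr => k _ /=; rewrite scalerA -scalerDl; congr (_ *: _);
  rewrite mulr_sumr -big_split; apply: eq_bigr => i _;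
  rewrite mulr_sumr -big_split; apply: eq_bigr => j _;
  by rewrite linearP /=; ring.
Qed.

HB.instance Definition _ :=
  bilinear_isBilinear.Build K V V V _ _ table_mul table_mul_is_bilinear.

Lemma table_mulC x y : table_mul x y = - table_mul y x.
Proof.
rewrite /table_mul -sumrN; apply: eq_bigr => k _; rewrite -scaleNr.
rewrite exchange_big -sumrN; congr (_ *: _); apply: eq_bigr => i _.
rewrite -sumrN; apply: eq_bigr => j _; rewrite antisymC; ring.
Qed.

Definition table_alg : ssAlg V := @SsAlg K V table_mul table_mulC.

Lemma mul_table_alg i j k : mul_table table_alg i j k = C i j k.
Proof.
rewrite /mul_table /= /table_mul coord_lincomb (bigD1 i) //=.
rewrite [X in _ + X]big1 => [|i' ii']; last first.
  by apply: big1 => j' _; rewrite !coord_tnth (negbTE ii') !mul0r.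
rewrite addr0 (bigD1 j) //= [X in _ + X]big1 => [|j' jj']; last first.
  by rewrite !coord_tnth (negbTE jj') mulr0 mul0r.
by rewrite !coord_tnth !eqxx !mul1r addr0.
Qed.

End AlgebraOfTable.
End StructureConstants.

(** * An algebra with nonzero determinant *)

(* (i, j, k) stands for e_i e_j = e_k, counting from 0. A computer search selected this algebra:
   each equation of its system, in a suitable order, determines one new entry
   of f. *)
Definition witness_prod (i j k : nat) : bool :=
  (i, j, k) \in [:: (0, 2, 0); (0, 3, 3); (1, 2, 3); (1, 3, 2); (2, 3, 1)]%N.

Definition witness_table (R : comNzRingType) (i j k : 'I_4) : R :=
  (witness_prod i j k)%:R - (witness_prod j i k)%:R.

Lemma witness_tableC (R : comNzRingType) i j k :
  witness_table R i j k = - witness_table R j i k.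
Proof. by rewrite /witness_table opprB. Qed.

Lemma big_ord4_inord (R : nmodType) (f : 'I_4 -> R) :
  \sum_i f i = f (inord 0) + f (inord 1) + f (inord 2) + f (inord 3).
Proof.
rewrite !big_ord_recr big_ord0 /= add0r.
by congr (f _ + f _ + f _ + f _); apply: val_inj; rewrite /= inordK.
Qed.

Lemma eq_of_scaled (R : pzRingType) (c a b x : R) :
  x = 0 -> a - b = c * x -> a = b.
Proof. by move=> -> /eqP; rewrite mulr0 subr_eq0 => /eqP. Qed.

Lemma inordD4 t u : (t < 4)%N -> (u < 4)%N ->
  inord t + inord u = inord ((t + u) %% 4) :> 'I_4.
Proof. by move=> t4 u4; apply: val_inj; rewrite /= !inordK ?ltn_mod. Qed.

(** Once the sums are expanded and the table entries computed, [c] times the left side of equation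
    [(t, l)] is the difference of the two sides of the goal; [c] is a sign. *)
Local Ltac solve_row row c t l :=
  apply: (eq_of_scaled (c := c) (row t l isT));
  rewrite /jacobi_term !big_ord4_inord /witness_table !inordK //=; ring.

Lemma witness_det_neq0 (K : fieldType) :
  hom_jacobi_det (witness_table K) != 0.
Proof.
apply/negP => /hom_jacobi_det_eq0P[F /eqP F0 /matrixP E]; apply: F0.
pose G s m := F (inord s) (inord m).
(* Equation [(t, l)] with every index an [inord] of a natural number, so that the table entries
   compute. *)
have row t l : (t < 4)%N ->
    let i := inord ((t + 1) %% 4) in let j := inord ((t + 2) %% 4) in
    let k := inord ((t + 3) %% 4) in
    let T i j k := jacobi_term (witness_table K) F i j k (inord l) in
    T i j k + T j k i + T k i j = 0.
  move=> t4 /=; have := E (inord t) (inord l); rewrite !mxE -!inordD4 //.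
  have inordE u : (u < 4)%N -> inord u = u%:R :> 'I_4.
    by move=> u4; apply: val_inj; rewrite /= Zp_nat /= inordK // modn_small.
  by rewrite (inordE 1%N) // (inordE 2%N) // (inordE 3%N).
(* Eight equations contain a single entry of [F], up to sign. *)
have G20 : G 2 0 = 0 by rewrite /G; solve_row row (1 : K) 0%N 0%N.
have G32 : G 3 2 = 0 by rewrite /G; solve_row row (1 : K) 1%N 0%N.
have G22 : G 2 2 = 0 by rewrite /G; solve_row row (1 : K) 1%N 1%N.
have G00 : G 0 0 = 0 by rewrite /G; solve_row row (-1 : K) 2%N 0%N.
have G11 : G 1 1 = 0 by rewrite /G; solve_row row (1 : K) 2%N 2%N.
have G12 : G 1 2 = 0 by rewrite /G; solve_row row (-1 : K) 3%N 0%N.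
have G02 : G 0 2 = 0 by rewrite /G; solve_row row (-1 : K) 3%N 1%N.
have G01 : G 0 1 = 0 by rewrite /G; solve_row row (-1 : K) 3%N 2%N.
(* Each of the other eight equations expresses one new entry through entries already known to
   vanish. *)
have G13 : G 1 3 = 0.
  suff -> : G 1 3 = - G 0 0 by rewrite G00; ring.
  by rewrite /G; solve_row row (-1 : K) 3%N 3%N.
have G23 : G 2 3 = 0.
  suff -> : G 2 3 = - G 3 2 by rewrite G32; ring.
  by rewrite /G; solve_row row (-1 : K) 0%N 1%N.
have G31 : G 3 1 = 0.
  suff -> : G 3 1 = G 1 3 by rewrite G13; ring.
  by rewrite /G; solve_row row (-1 : K) 0%N 2%N.
have G33 : G 3 3 = 0.
  suff -> : G 3 3 = - G 0 2 - G 2 0 by rewrite G02 G20; ring.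
  by rewrite /G; solve_row row (1 : K) 1%N 3%N.
have G03 : G 0 3 = 0.
  suff -> : G 0 3 = - G 1 2 by rewrite G12; ring.
  by rewrite /G; solve_row row (1 : K) 2%N 1%N.
have G10 : G 1 0 = 0.
  suff -> : G 1 0 = G 0 1 by rewrite G01; ring.
  by rewrite /G; solve_row row (1 : K) 2%N 3%N.
have G21 : G 2 1 = 0.
  suff -> : G 2 1 = - G 0 3 by rewrite G03; ring.
  by rewrite /G; solve_row row (1 : K) 1%N 2%N.
have G30 : G 3 0 = 0.
  suff -> : G 3 0 = G 1 2 + G 2 1 by rewrite G12 G21; ring.
  by rewrite /G; solve_row row (-1 : K) 0%N 3%N.
apply/matrixP => s m; rewrite mxE -(inord_val s) -(inord_val m) -/(G s m).
case: s m => [[|[|[|[|s]]]] //= _] [[|[|[|[|m]]]] //= _].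
Qed.

(** * The nonvanishing locus of the determinant *)

Section FourDimensional.
Variables (K : fieldType) (V : vectType K) (e : 4.-tuple V).
Hypothesis basis_e : basis_of {:V} e.

Lemma admits_hom_lie_det_eq0 (mu : ssAlg V) :
  admits_hom_lie mu -> hom_jacobi_det (mul_table e mu) = 0.
Proof.
case=> f f_neq0 jac_f; apply/eqP/hom_jacobi_det_eq0P.
exists (end_mx e f); first by rewrite end_mx_eq0.
(* Entry [(t, l)] is the coordinate on [e_l] of the identity at the basis vectors of indices
   [t + 1], [t + 2], [t + 3]. *)
apply/matrixP => t l; rewrite !mxE -!coord_jacobi_term //.
by rewrite -!linearD jac_f linear0.
Qed.

Lemma hom_jacobi_det_eval (mu : ssAlg V) : 2%:R != 0 :> K ->
  (hom_jacobi_det (@generic_table K 4)).@[struct_const e mu]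
    = hom_jacobi_det (mul_table e mu).
Proof.
move=> two_neq0; apply: rmorph_hom_jacobi_det => i j k.
exact: generic_table_eval.
Qed.

End FourDimensional.

Theorem proposition20 (K : fieldType) (charK0 : [pchar K] =i pred0)
    (V : vectType K) (dimV : \dim {:V} = 4%N)
    (e : 4.-tuple V) (basis_e : basis_of {:V} e) :
  exists U : ssAlg V -> Prop,
    [/\ ssAlg_open e U,
        exists mu, U mu
      & forall mu, U mu -> ~ admits_hom_lie mu].
Proof.
have two_neq0 : 2%:R != 0 :> K by rewrite ((pcharf0P K).1 charK0).
pose p := hom_jacobi_det (@generic_table K 4).
exists (fun mu => p.@[struct_const e mu] != 0); split.
- exists (fun v => p.@[v] != 0) => //.
  (* The defining family consists of [p] alone. *)
  by exists (eq p) => v; split=> [pv|[_ <-]] //; exists p.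
- exists (table_alg e (@witness_tableC K)).
  rewrite hom_jacobi_det_eval //.
  rewrite -(rmorph_hom_jacobi_det (phi := idfun) (C := witness_table K)).
    exact: witness_det_neq0.
  by move=> i j k; rewrite mul_table_alg.
- move=> mu; rewrite hom_jacobi_det_eval // => det_neq0.
  by move/(admits_hom_lie_det_eq0 basis_e)/eqP; apply/negP.
Qed.
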